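(* Let $k\ge 0$ be an integer. For every $k$-degenerate graph $G$ on $n$ vertices, $\mathrm{cub}(G) \le (k+2)\cdot\lceil 2e\log n\rceil$.
   Context: All graphs are simple, finite and undirected; $\log$ denotes the natural logarithm and $e$ its base. A graph $G$ is $k$-degenerate if its vertices can be enumerated so that every vertex is succeeded by at most $k$ of its neighbors. A $k$-cube is a Cartesian product $R_1\times\cdots\times R_k$ of closed intervals of unit length on the real line. The cubicity $\mathrm{cub}(G)$ is the minimum integer $k\ge 0$ such that $G$ is an intersection graph of $k$-cubes, i.e. each vertex can be assigned a $k$-cube so that two distinct vertices are adjacent iff their $k$-cubes intersect (a $0$-cube is a single point, so complete graphs have cubicity $0$). *)

(* Defs.v *)
From HB Require Import structures.
From mathcomp Require Import all_boot all_order all_algebra.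
From mathcomp Require Import lra.
From mathcomp Require Import all_classical all_reals all_analysis.

Set Implicit Arguments.
Unset Strict Implicit.
Unset Printing Implicit Defensive.

Import Order.TTheory GRing.Theory Num.Theory.

Local Open Scope classical_set_scope.
Local Open Scope ring_scope.

Record sgraph := SGraph {
  vertex :> finType;
  adj : rel vertex;
  adj_sym : symmetric adj;
  adj_irr : irreflexive adj }.

Definition degenerate (k : nat) (G : sgraph) : Prop :=
  exists s : seq G,
    [/\ uniq s, (forall v : G, v \in s)
      & forall v : G,
          (#|[set u : G | adj v u && (index v s < index u s)%N]%SET| <= k)%N].

Definition is_cube (R : realType) (d : nat) (C : set 'rV[R]_d) : Prop :=
  exists a : 'rV[R]_d,
    C = [set x : 'rV[R]_d | forall i : 'I_d, x ord0 i \in `[a ord0 i, a ord0 i + 1]].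

Definition cube_representable (R : realType) (G : sgraph) (d : nat) : Prop :=
  exists C : G -> set 'rV[R]_d,
    (forall v, is_cube (C v)) /\
    (forall u v : G, u != v -> (adj u v <-> C u `&` C v !=set0)).

(* One coordinate per vertex w: the interval of w starts at 0, those of its
   neighbours at 1, and all others at 2. *)
Lemma cube_representable_card (R : realType) (G : sgraph) :
  cube_representable R G #|G|.
Proof.
pose f (w u : G) : R := if u == w then 0 else if adj w u then 1 else 2.
pose a (u : G) : 'rV[R]_#|G| := \row_i f (enum_val i) u.
have f_adj w u v : adj u v -> f w u <= f w v + 1.
  move=> auv; rewrite /f; case: (eqVneq v w) => [<-|_].
    by rewrite adj_sym auv; case: ifP => _; lra.
  by case: ifP => _; do ?case: ifP => _; lra.
exists (fun u => [set x : 'rV[R]_#|G| | forall i,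
  x ord0 i \in `[a u ord0 i, a u ord0 i + 1]]).
split=> [v|u v uv]; first by exists (a v).
split=> [auv|[x [/= xu xv]]].
  have avu : adj v u by rewrite adj_sym.
  exists (\row_i Order.max (a u ord0 i) (a v ord0 i)); split=> i /=;
    rewrite !mxE in_itv /= le_max ge_max !lexx ?orbT /=.
    by rewrite lerDl ler01 f_adj.
  by rewrite lerDl ler01 f_adj.
have := xu (enum_rank u); have := xv (enum_rank u).
rewrite !mxE !in_itv /= /f enum_rankK eqxx eq_sym (negPf uv).
case: (adj u v) => //; lra.
Qed.

Lemma cube_representable_ex (R : realType) (G : sgraph) :
  exists d, `[< cube_representable R G d >].
Proof. by exists #|G|; apply/asboolP; exact: cube_representable_card. Qed.

Definition cubicity (R : realType) (G : sgraph) : nat :=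
  ex_minn (cube_representable_ex R G).

(* Main.v *)
Require Import Defs.
From mathcomp Require Import all_boot all_order all_algebra.
From mathcomp Require Import lra.
From mathcomp Require Import all_classical all_reals all_analysis.

Set Implicit Arguments.
Unset Strict Implicit.
Unset Printing Implicit Defensive.

Import Order.TTheory GRing.Theory Num.Theory.

Local Open Scope ring_scope.

(* Colour the vertices with k + 2 colours. Each pair (f, c) of a colouring and
   a colour gives a unit interval supergraph of G: a vertex of colour c at index
   i of the degeneracy order starts at -i/N, any other vertex u starts at
   1 - m/N, with m the largest index among u and its neighbours of colour c.
   It separates non-adjacent u, v, with u first and c the colour of v, whenever
   neither u nor a later neighbour of u has colour c. At most k + 1 vertices have
   to avoid c, so a random colouring does it with probability at least
   (1 - 1/(k+2))^(k+1) >= 1/e. Averaging, some colouring separates a proportion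
   1/e of the remaining pairs; after 2 e log n greedy rounds fewer than
   (1 - 1/e)^(2 e log n) * n^2 <= 1 pairs are left. *)

(** Unit intervals meet exactly when their left endpoints differ by at most 1, so [p i u] serves as
    the left endpoint of the box of [u] in coordinate [i]. *)
Lemma cube_representable_dist (R : realType) (G : sgraph) (I : finType)
    (p : I -> G -> R) :
    (forall i u v, adj u v -> `|p i u - p i v| <= 1) ->
    (forall u v, u != v -> ~~ adj u v -> exists i, 1 < `|p i u - p i v|) ->
  cube_representable R G #|I|.
Proof.
move=> p_adj p_sep; pose a u : 'rV[R]_#|I| := \row_i p (enum_val i) u.
exists (fun u => [set x : 'rV[R]_#|I| | forall i,
  (x ord0 i \in `[a u ord0 i, a u ord0 i + 1])%R])%classic.
split=> [v|u v uv]; first by exists (a v).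
split=> [auv|[x [/= xu xv]]].
  exists (\row_i Order.max (a u ord0 i) (a v ord0 i)); split=> i /=;
    rewrite !mxE in_itv /= le_max ge_max !lexx ?orbT /=;
    by have := p_adj (enum_val i) _ _ auv; rewrite ler_norml => /andP[]; lra.
apply: contraT => /(p_sep _ _ uv)[i].
have := xu (enum_rank i); have := xv (enum_rank i).
rewrite !mxE !in_itv /= enum_rankK => /andP[? ?] /andP[? ?].
by rewrite ltr_normr => /orP[]; lra.
Qed.

(** The avoidance probability [(q/(q+1))^|S|], cross-multiplied to stay in the naturals. Once the
    colour of [v] is fixed, each element of [S] keeps [q] choices and every other element [q+1]. *)
Lemma card_ffun_avoid (T : finType) (q : nat) (v : T) (S : {set T}) :
    v \notin S ->
  (#|[set f : {ffun T -> 'I_q.+1} | f v \notin f @: S]| * q.+1 ^ #|S| =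
    q ^ #|S| * q.+1 ^ #|T|)%N.
Proof.
move=> vS; pose F c (x : T) : pred 'I_q.+1 :=
  if x == v then pred1 c else if x \in S then predC1 c else predT.
have cardF c : (#|family (F c)| * q.+1 * q.+1 ^ #|S| =
    q ^ #|S| * q.+1 ^ #|T|)%N.
  rewrite card_family foldrE big_map big_enum /= (bigD1 v) //=.
  rewrite {1}/F eqxx card1 mul1n (bigID (mem S)) /=.
  rewrite (eq_bigl (mem S)); last first.
    by move=> x; case: eqVneq => [->|//]; rewrite inE (negPf vS).
  rewrite (eq_bigr (fun=> q)) => [|x xS]; last first.
    rewrite /F ifN; first by rewrite [x \in S]xS cardC1 card_ord.
    by apply: contraTneq (xS : x \in S) => ->.
  rewrite [X in (_ * X * _ * _)%N](eq_bigr (fun=> q.+1)); last first.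
    by move=> x /andP[/negPf xv /negPf xS]; rewrite /F xv [x \in S]xS card_ord.
  rewrite !prod_nat_const -!mulnA -expnS -expnD; congr (_ * _ ^ _)%N.
  rewrite -[RHS](cardC (mem S)) -addSnnS addnC; congr (_ + _)%N.
  rewrite [RHS](cardD1 v) !inE vS add1n; congr _.+1.
apply/eqP; rewrite -(@eqn_pmul2r q.+1) // mulnAC; apply/eqP.
have -> : (#|[set f : {ffun T -> 'I_q.+1} | f v \notin f @: S]| =
    \sum_(c : 'I_q.+1) #|family (F c)|)%N.
  rewrite -sum1_card (partition_big (fun f : {ffun T -> 'I_q.+1} => f v) predT) //=.
  apply: eq_bigr => c _; rewrite -sum1_card; apply: eq_bigl => f; rewrite !inE.
  apply/andP/familyP => [[fS /eqP <-] x|fF].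
    rewrite /F; case: eqVneq => [->|_]; first exact: eqxx.
    case: ifP => // xS; apply: contraNneq fS => <-; exact: imset_f.
  have := fF v; rewrite /F eqxx => /eqP fv; split; last exact/eqP.
  apply/imsetP => -[x xS fvx]; have := fF x.
  rewrite /F xS; case: eqVneq xS => [->|_ _]; first by rewrite (negPf vS).
  by rewrite inE /= -fvx fv eqxx.
rewrite big_distrl /= big_distrl /= (eq_bigr _ (fun c _ => cardF c)).
by rewrite sum_nat_const card_ord mulnC.
Qed.

(** For [q > 0] this is [(1 + 1/q)^m <= e], from [1 + x <= exp x] and [m <= q]; [q = 0] forces
    [m = 0]. *)
Lemma succn_exp_le_expR (R : realType) (q m : nat) : (m <= q)%N ->
  (q.+1%:R : R) ^+ m <= expR 1 * q%:R ^+ m.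
Proof.
case: q => [|q mq].
  by rewrite leqn0 => /eqP ->; rewrite !expr0 mulr1 -expR0 ler_expR.
have q0 : (0 : R) < q.+1%:R by rewrite ltr0n.
rewrite -ler_pdivrMr ?exprn_gt0 // -expr_div_n -addn1 natrD mulrDl divff ?gt_eqF //.
apply: le_trans (_ : expR (q.+1%:R^-1) ^+ m <= _).
  by rewrite lerXn2r ?nnegrE ?expR_ge0 ?addr_ge0 ?invr_ge0 // div1r expR_ge1Dx.
rewrite -expRM_natl ler_expR mulr_natl -mulr_natr mulrC.
by rewrite ler_pdivrMr // mul1r ler_nat.
Qed.

(** Averaging: each [i] in [P] is good for at least a proportion [1/e] of all colourings, so some
    colouring is good for at least that proportion of [P]. *)
Lemma exists_good_ffun (R : realType) (T I : finType) (q : nat)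
    (v : I -> T) (S : I -> {set T}) (P : {set I}) :
    (forall i, i \in P -> v i \notin S i) ->
    (forall i, i \in P -> #|S i| <= q)%N ->
  exists f : {ffun T -> 'I_q.+1},
    #|P|%:R <= expR 1 * #|[set i in P | f (v i) \notin f @: S i]|%:R :> R.
Proof.
move=> vS Sq; pose K : R := #|{ffun T -> 'I_q.+1}|%:R.
have q0 m : 0 < (q.+1%:R : R) ^+ m by rewrite exprn_gt0 ?ltr0n.
apply/existsP; apply: contraT; rewrite negb_exists => /forallP bad.
(* If every colouring failed, summing would give this strict bound; strictness needs at least one
   colouring, here the constant one. *)
have : \sum_(f : {ffun T -> 'I_q.+1})
    expR 1 * #|[set i in P | f (v i) \notin f @: S i]|%:R < K * #|P|%:R :> R.
  rewrite /K mulr_natl -sumr_const; apply: ltr_sum => [|f _].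
    by apply/hasP; exists [ffun=> ord0]; rewrite ?mem_index_enum.
  by rewrite ltNge bad.
rewrite ltNge -mulr_sumr; case/negP.
(* Double counting of the good pairs [(f, i)]. *)
have -> : \sum_(f : {ffun T -> 'I_q.+1}) #|[set i in P | f (v i) \notin f @: S i]|%:R =
    \sum_(i in P) #|[set f : {ffun T -> 'I_q.+1} | f (v i) \notin f @: S i]|%:R :> R.
  rewrite -!natr_sum; congr _%:R.
  under eq_bigr do rewrite -sum1dep_card.
  rewrite (exchange_big_dep (mem P)) /=; last by move=> ? ? _ /andP[].
  by apply: eq_bigr => i iP; rewrite -sum1dep_card; apply: eq_bigl => f; rewrite iP.
rewrite mulr_sumr mulr_natr -sumr_const; apply: ler_sum => i iP.
have /(congr1 (fun m => m%:R : R)) := card_ffun_avoid q (vS _ iP).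
rewrite -(ler_pM2r (q0 #|S i|)) -mulrA !natrM !natrX => ->.
rewrite /K card_ffun card_ord natrX mulrA mulrC (ler_pM2r (q0 _)).
exact: succn_exp_le_expR (Sq _ iP).
Qed.

Lemma exists_good_ffuns (R : realType) (T I : finType) (q t : nat)
    (v : I -> T) (S : I -> {set T}) (P : {set I}) :
    (forall i, i \in P -> v i \notin S i) ->
    (forall i, i \in P -> #|S i| <= q)%N ->
  exists f : 'I_t -> {ffun T -> 'I_q.+1},
    #|[set i in P | [forall j, f j (v i) \in f j @: S i]]|%:R
      <= (1 - (expR 1)^-1) ^+ t * #|P|%:R :> R.
Proof.
move=> + Sq; elim: t P Sq => [|t IH] P Sq vS.
  exists (fun=> [ffun=> ord0]); rewrite expr0 mul1r ler_nat.
  by apply: subset_leq_card; apply/fintype.subsetP => i; rewrite inE => /andP[].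
have [f0 Pf0] := exists_good_ffun R vS Sq.
(* The induction continues on [Q], what [f0] leaves bad; it has size at most [(1 - 1/e) |P|]. *)
set Q := [set i in P | f0 (v i) \in f0 @: S i].
have QP i : i \in Q -> i \in P by rewrite inE => /andP[].
have [i /QP|i /QP|f Pf] := IH Q; [exact: Sq|exact: vS|].
exists (fun j => if unlift ord0 j is Some j' then f j' else f0).
apply: le_trans (_ : _ <= #|[set i in Q | [forall j, f j (v i) \in f j @: S i]]|%:R) _.
  rewrite ler_nat; apply: subset_leq_card; apply/fintype.subsetP => i.
  rewrite !inE => /andP[-> /forallP fi] /=.
  have := fi ord0; rewrite unlift_none => -> /=.
  by apply/forallP => j; have := fi (lift ord0 j); rewrite liftK.
apply: le_trans Pf _; have e1 : 1 <= expR 1 :> R by rewrite -[leLHS]expR0 ler_expR.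
rewrite exprSr -mulrA ler_wpM2l ?exprn_ge0 // ?subr_ge0 ?invf_le1 ?expR_gt0 //.
have cardP : #|P|%:R = #|Q|%:R + #|[set i in P | f0 (v i) \notin f0 @: S i]|%:R :> R.
  rewrite -natrD -(cardsID [set i | f0 (v i) \in f0 @: S i] P).
  by congr (_ + _)%:R; apply: eq_card => i; rewrite !inE // andbC.
rewrite mulrBl mul1r lerBrDr addrC -lerBrDr.
by rewrite mulrC ler_pdivrMr ?expR_gt0 // [X in X - _]cardP addrAC subrr add0r mulrC.
Qed.

Lemma degenerate_separation (R : realType) (k : nat) (G : sgraph) (t : nat) :
    degenerate k G -> ln (#|G|%:R : R) * (2 * expR 1) <= t%:R ->
  exists (s : seq G) (f : 'I_t -> {ffun G -> 'I_k.+2}),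
    [/\ uniq s, forall v, v \in s &
    forall u v, ~~ adj u v -> (index u s < index v s)%N ->
      exists j, forall w, w = u \/ adj u w /\ (index u s < index w s)%N ->
        f j w != f j v].
Proof.
move=> [s [us ms ks]] tG.
pose S (p : G * G) := p.1 |: [set w | adj p.1 w && (index p.1 s < index w s)%N].
pose P := [set p : G * G | ~~ adj p.1 p.2 && (index p.1 s < index p.2 s)%N].
(* With [q = k+1], the set [S p] of vertices that must avoid the colour of [p.2] fits the counting
   lemmas. *)
have vS p : p \in P -> p.2 \notin S p.
  rewrite !inE => /andP[/negPf -> pp]; rewrite orbF.
  by apply: contraTneq pp => ->; rewrite ltnn.
have Sk p : p \in P -> (#|S p| <= k.+1)%N.
  move=> _; rewrite cardsU1 -(add1n k) leq_add ?leq_b1 //; exact: ks.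
have [f Pf] := exists_good_ffuns R t vS Sk.
exists s, f; split=> // u v uv suv.
suff : #|[set p in P | [forall j, f j p.2 \in f j @: S p]]|%:R < 1 :> R.
  rewrite ltrn1 ltnS leqn0 cards_eq0 => /eqP/setP/(_ (u, v)); rewrite !inE uv suv /=.
  move=> /negbT; rewrite negb_forall => /existsP[j fj]; exists j => w uw.
  apply: contraNneq fj => <-; apply: imset_f; rewrite !inE.
  by case: uw => [->|[-> ->]]; rewrite ?eqxx ?orbT.
have G0 : (0 < #|G|)%N by apply/card_gt0P; exists u.
have N0 : 0 < #|G|%:R :> R by rewrite ltr0n.
apply: le_lt_trans Pf _.
(* Here [1 - 1/e <= exp (-1/e)], and [t/e >= 2 ln |G|] by [tG]. *)
have tN : (1 - (expR 1)^-1) ^+ t <= (#|G|%:R ^+ 2)^-1 :> R.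
  apply: le_trans (_ : expR (- (expR 1)^-1) ^+ t <= _).
    rewrite lerXn2r ?nnegrE ?expR_ge0 ?expR_ge1Dx //.
    by rewrite subr_ge0 invf_le1 ?expR_gt0 // -[leLHS]expR0 ler_expR.
  rewrite -expRM_natl -[X in _ <= X^-1](@lnK _) ?posrE ?exprn_gt0 //.
  rewrite -(expRN (ln _)) ler_expR lnXn // mulrN lerN2 ler_pdivlMr ?expR_gt0 //.
  by rewrite -[ln _ *+ 2]mulr_natr -mulrA.
apply: le_lt_trans (ler_wpM2r _ tN) _; rewrite ?ler0n // mulrC.
(* [P] misses the diagonal, so [|P| < |G|^2]: this makes the final bound strict. *)
rewrite ltr_pdivrMr ?exprn_gt0 // mul1r -natrX ltr_nat -mulnn -card_prod -cardsT.
apply: proper_card; rewrite properT.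
by apply/eqP => /setP/(_ (u, u)); rewrite !inE /= ltnn andbF.
Qed.

Lemma cube_representable_degenerate (R : realType) (k t : nat) (G : sgraph) :
    degenerate k G -> ln (#|G|%:R : R) * (2 * expR 1) <= t%:R ->
  cube_representable R G (t * (k + 2)).
Proof.
move=> /degenerate_separation + tG => /(_ _ _ tG)[s [f [us ms f_sep]]].
rewrite addn2 -[t]card_ord -[k.+2]card_ord -card_prod.
pose idx (u : G) := index u s.
pose reach j c u : nat :=
  \max_(w | (w == u) || adj u w && (f j w == c)) idx w.
(* Any order embedding of the indices into [[0, 1]] would do. *)
have [r r01 r_le] : exists2 r : nat -> R,
    forall m, (m < #|G|)%N -> 0 <= r m <= 1
    & {mono r : m1 m2 / (m1 <= m2)%N >-> m1 <= m2}.
  exists (fun m => m%:R / #|G|.+1%:R) => [m mG|m1 m2]; last first.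
    by rewrite ler_pM2r ?invr_gt0 ?ltr0n // ler_nat.
  by rewrite divr_ge0 //= ler_pdivrMr ?ltr0n // mul1r ler_nat ltnW // ltnW.
pose p (i : 'I_t * 'I_k.+2) u : R :=
  if f i.1 u == i.2 then - r (idx u) else 1 - r (reach i.1 i.2 u).
have idx_lt u : (idx u < #|G|)%N.
  apply: (@leq_trans (size s)); first by rewrite index_mem.
  by rewrite -(card_uniqP us) max_card.
have reach_lt j c u : (reach j c u < #|G|)%N.
  have N0 : (0 < #|G|)%N by apply: leq_ltn_trans (idx_lt u).
  rewrite -(prednK N0) ltnS; apply/bigmax_leqP => w _.
  by rewrite -ltnS (prednK N0).
have p_le i u v : adj u v -> p i u - p i v <= 1.
  case: i => j c auv; rewrite /p /=.
  have /andP[? ?] := r01 _ (idx_lt u); have /andP[? ?] := r01 _ (idx_lt v).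
  have /andP[? ?] := r01 _ (reach_lt j c u).
  have /andP[? ?] := r01 _ (reach_lt j c v).
  case: ifP => _; case: ifP => [fv|_]; [clear fv; lra|lra| |lra].
  (* The only tight case: [v] has colour [c] and [u] does not, so [v] is one of the neighbours
     counted in [reach j c u]. *)
  have : r (idx v) <= r (reach j c u).
    by rewrite r_le; apply: leq_bigmax_cond; rewrite auv fv orbT.
  clear fv; lra.
have p_lt u v : ~~ adj u v -> (idx u < idx v)%N ->
    exists i, 1 < `|p i u - p i v|.
  move=> nuv uv; have [j fj] := f_sep _ _ nuv uv.
  exists (j, f j v); rewrite /p /= eqxx (negPf (fj u _)); last by left.
  rewrite ltr_normr; apply/orP; left.
  (* The difference of endpoints is [1 - r (reach j (f j v) u) + r (idx v)]. A neighbour of [u]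
     sharing the colour of [v] cannot come after [u], so the reach is at most [idx u < idx v]. *)
  suff ? : r (reach j (f j v) u) < r (idx v) by lra.
  rewrite ltNge r_le -ltnNge; apply: leq_ltn_trans uv.
  apply/bigmax_leqP => w /orP[/eqP -> //|/andP[uw fw]].
  by rewrite leqNgt; apply: contraL fw => ?; apply: fj; right.
apply: (cube_representable_dist (p := p)) => [i u v auv|u v uv nuv].
  rewrite ler_norml p_le // andbT lerNl opprB p_le //.
  by rewrite adj_sym.
have [|vu|iuv] := ltngtP (idx u) (idx v); first exact: p_lt.
  have [|i] := p_lt v u _ vu; first by rewrite adj_sym.
  by exists i; rewrite distrC.
by case/eqP: uv; rewrite -(nth_index u (ms u)) -/(idx u) iuv nth_index.
Qed.

Theorem theorem1 (R : realType) (k n : nat) (G : sgraph)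
    (hn : #|G| = n) (hG : degenerate k G) :
  (cubicity R G)%:Z <= (k + 2)%:Z * Num.ceil (2 * expR 1 * ln (n%:R : R)).
Proof.
set x := 2 * expR 1 * ln _.
have x0 : 0 <= x.
  rewrite mulr_ge0 ?mulr_ge0 ?expR_ge0 //.
  (* The empty graph is covered by the convention that [ln 0 = 0]. *)
  by case: (n) => [|m]; [rewrite ln0|rewrite ln_ge0 // ler1n].
have [t tx] : exists t : nat, Num.ceil x = t%:Z.
  exists `|Num.ceil x|%N.
  by rewrite gez0_abs // ceil_ge0 (lt_le_trans _ x0) // ltrN10.
rewrite tx -PoszM lez_nat mulnC /cubicity; case: ex_minnP => d _; apply.
apply/asboolP/cube_representable_degenerate => //.
by rewrite hn mulrC; have := ceil_ge x; rewrite tx.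
Qed.
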